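(* Let $m>0$. Let $B_0=0$, $B_{t+1}=B_t+\frac12\left(1+\sqrt{4B_t+1}\right)$ and $A_t=B_t+\frac1m$ for integers $t\ge0$. Define $\Theta_0=Z_0=Y_0=0$ and, for $t\ge1$, $\Theta_t=Y_{t-1}+m$, $Z_t=Z_{t-1}+m(A_t-A_{t-1})$, $Y_t=\Theta_t+\left(1-\frac{A_t}{A_{t+1}}\right)(Z_t-\Theta_t)$. Let $S_0=\Theta_0=0$, $S_1=Y_1=m$, and $S_{2j}=\Theta_{j+1}$, $S_{2j+1}=Y_{j+1}$ for all $j\ge1$; this is a strictly increasing sequence. Let $d_j=1$ for all $j\ge0$, and let $F:\mathbb{R}\to\mathbb{R}$ be the function built from $(S_j)$ and $(d_j)$ as described in the context. Let $\theta_0=0$ and let $(\theta_k)_{k\ge0}$ and $(y_k)_{k\ge0}$ be generated by Nesterov's accelerated gradient method with step size $m$ (described in the context) applied to $F$. Then $\lim_k F(\theta_k)=\infty$, $\lim_k F(y_k)=\infty$, and $\inf_k|\dot F(\theta_k)|=\inf_k|\dot F(y_k)|=1$.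
   Context: $\dot F$ denotes the derivative of $F$. Nesterov's accelerated gradient method with step size $m>0$ and initial point $\theta_0$: set $z_0=\theta_0$, $B_0=0$, $A_0=1/m$; for $t=0,1,2,\dots$ set $B_{t+1}=B_t+\frac12(1+\sqrt{4B_t+1})$, $A_{t+1}=B_{t+1}+\frac1m$, $y_t=\theta_t+\left(1-\frac{A_t}{A_{t+1}}\right)(z_t-\theta_t)$, $\theta_{t+1}=y_t-m\dot F(y_t)$, $z_{t+1}=z_t-m(A_{t+1}-A_t)\dot F(y_t)$. For $m>0$ and $d,\delta\in(0,1]$ let $f(\cdot\,;m,d,\delta):[0,m]\to\mathbb{R}$ be given by $$f(\theta;m,d,\delta)=\begin{cases} -d\theta & \theta\in(0,\frac{2-d}{16}m)\\ \frac{8}{m}(\theta-\frac m8)^2-m\frac{-d^2+4d}{32} & \theta\in[\frac{2-d}{16}m,\frac{3}{16}m)\\ -\frac{5m}{16}\exp\left(\frac{5/16}{\theta/m-1/2}+1\right)+m\frac{11+d^2-4d}{32} & \theta\in(\frac{3}{16}m,\frac12 m)\\ m\frac{11+d^2-4d}{32} & \theta=\frac12 m\\ \frac{5m}{16}\exp\left(\frac{-5/16}{\theta/m-1/2}+1\right)+m\frac{11+d^2-4d}{32} & \theta\in(\frac12 m,\frac{13}{16}m)\\ -\frac{8}{m}(\theta-\frac{7m}{8})^2+m\frac{22+d^2-4d}{32} & \theta\in[\frac{13}{16}m,\frac{\delta+14}{16}m)\\ -\delta\theta+m\frac{22+d^2+\delta^2-4d+28\delta}{32} & \theta\in[\frac{\delta+14}{16}m,m]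 \end{cases}$$ and extended to $\theta=0$ and $\theta=\frac{3}{16}m$ by continuity. Given a strictly increasing real sequence $(S_j)_{j\ge0}$ and a sequence $(d_j)_{j\ge 0}$ in $(0,1]$, the function $F$ is defined (recursively in $j$) on $(-\infty,\sup_j S_j)$ by $F(\theta)=-d_0(\theta-S_0)$ for $\theta\le S_0$; $F(\theta)=f(\theta-S_0;S_1-S_0,d_0,d_1)$ for $\theta\in(S_0,S_1]$; and $F(\theta)=f(\theta-S_j;S_{j+1}-S_j,d_j,d_{j+1})+F(S_j)$ for $\theta\in(S_j,S_{j+1}]$, $j=1,2,\dots$. It is defined on all of $\mathbb{R}$ when $\sup_j S_j=\infty$. *)

(* Defs.v *)
From Stdlib Require Import Reals Lra Lia PeanoNat.
From Coquelicot Require Import Coquelicot.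
Open Scope R_scope.

(* Only meant for 0 <= theta <= m.  The values at theta = 0 and
   theta = 3/16 m are those given by continuity: 0, and
   m (1 + d^2 - 4 d) / 32, the common limit of the second and third formulas
   (see [piece_3_16]). *)
Definition piece (theta m d delta : R) : R :=
  if Rlt_dec theta ((2 - d) / 16 * m) then - d * theta
  else if Rle_dec theta (3 / 16 * m) then
    8 / m * (theta - m / 8) ^ 2 - m * ((- d ^ 2 + 4 * d) / 32)
  else if Rlt_dec theta (1 / 2 * m) then
    - (5 * m / 16) * exp ((5 / 16) / (theta / m - 1 / 2) + 1)
    + m * ((11 + d ^ 2 - 4 * d) / 32)
  else if Req_dec_T theta (1 / 2 * m) then
    m * ((11 + d ^ 2 - 4 * d) / 32)
  else if Rlt_dec theta (13 / 16 * m) then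
    5 * m / 16 * exp ((- (5 / 16)) / (theta / m - 1 / 2) + 1)
    + m * ((11 + d ^ 2 - 4 * d) / 32)
  else if Rlt_dec theta ((delta + 14) / 16 * m) then
    - (8 / m) * (theta - 7 * m / 8) ^ 2 + m * ((22 + d ^ 2 - 4 * d) / 32)
  else
    - delta * theta
    + m * ((22 + d ^ 2 + delta ^ 2 - 4 * d + 28 * delta) / 32).

Lemma piece_3_16 (m d delta : R) : 0 < m -> 0 < d <= 1 ->
  piece (3 / 16 * m) m d delta = m * ((1 + d ^ 2 - 4 * d) / 32) /\
  - (5 * m / 16) * exp ((5 / 16) / ((3 / 16 * m) / m - 1 / 2) + 1)
    + m * ((11 + d ^ 2 - 4 * d) / 32) = m * ((1 + d ^ 2 - 4 * d) / 32).
Proof.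
intros hm hd; split.
- unfold piece; destruct Rlt_dec; [nra|]; destruct Rle_dec; [field; lra|lra].
- replace (5 / 16 / (3 / 16 * m / m - 1 / 2) + 1) with 0 by (field; lra).
  rewrite exp_0; field.
Qed.

(* The value at knot j of the function glued from the pieces. *)
Fixpoint knot_value (s d : nat -> R) (j : nat) : R :=
  match j with
  | O => 0
  | S i => piece (s (S i) - s i) (s (S i) - s i) (d i) (d (S i))
           + knot_value s d i
  end.

Lemma le_knot_dec (s : nat -> R) (theta : R) (j : nat) :
  theta <= s j \/ ~ theta <= s j.
Proof. lra. Qed.

(* [LPO_min] finds the least j with theta <= s j, so that for increasing s
   either theta <= s 0, or j = i + 1 and s i < theta <= s (i + 1).  The value 0
   is a dummy for theta above every s j. *)
Definition glue (s d : nat -> R) (theta : R) : R :=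
  match LPO_min (fun j => theta <= s j) (le_knot_dec s theta) with
  | inleft (exist O _) => - d 0%nat * (theta - s 0%nat)
  | inleft (exist (S i) _) =>
      piece (theta - s i) (s (S i) - s i) (d i) (d (S i)) + knot_value s d i
  | inright _ => 0
  end.

Lemma glue_left (s d : nat -> R) (theta : R) :
  theta <= s 0%nat -> glue s d theta = - d 0%nat * (theta - s 0%nat).
Proof.
intros h; unfold glue.
destruct LPO_min as [[[|i] [h1 h2]]|h1]; [reflexivity| |].
- exfalso; apply (h2 0%nat); [lia|exact h].
- exfalso; exact (h1 0%nat h).
Qed.

Lemma glue_piece_aux (s d : nat -> R) (j : nat) (theta : R) :
  (forall i, s i < s (S i)) -> s j < theta <= s (S j) ->
  glue s d theta =
    piece (theta - s j) (s (S j) - s j) (d j) (d (S j)) + knot_value s d j.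
Proof.
intros hs [h1 h2].
assert (mono : forall i k, (i <= k)%nat -> s i <= s k).
{ intros i k hik; induction hik as [|k hik IH]; [lra|].
  specialize (hs k); lra. }
unfold glue; destruct LPO_min as [[n [hn hmin]]|hn].
- assert (n = S j) as ->.
  { destruct (Nat.lt_trichotomy n (S j)) as [hl|[he|hg]]; [|exact he|].
    - pose proof (mono n j ltac:(lia)); lra.
    - exfalso; exact (hmin _ hg h2). }
  reflexivity.
- exfalso; exact (hn _ h2).
Qed.

Lemma glue_knot (s d : nat -> R) (j : nat) :
  (forall i, s i < s (S i)) -> glue s d (s j) = knot_value s d j.
Proof.
intros hs; destruct j as [|i].
- rewrite glue_left by lra; simpl; ring.
- rewrite (glue_piece_aux s d i); [reflexivity|exact hs|].
  specialize (hs i); lra.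
Qed.

Lemma glue_piece (s d : nat -> R) (j : nat) (theta : R) :
  (forall i, s i < s (S i)) -> s j < theta <= s (S j) ->
  glue s d theta =
    piece (theta - s j) (s (S j) - s j) (d j) (d (S j)) + glue s d (s j).
Proof.
intros hs h; rewrite (glue_knot s d j hs); exact (glue_piece_aux s d j theta hs h).
Qed.

Fixpoint nagB (t : nat) : R :=
  match t with
  | O => 0
  | S t' => nagB t' + 1 / 2 * (1 + sqrt (4 * nagB t' + 1))
  end.

Definition nagA (m : R) (t : nat) : R := nagB t + 1 / m.

Definition nag_mix (m : R) (t : nat) (theta z : R) : R :=
  theta + (1 - nagA m t / nagA m (S t)) * (z - theta).

(* The pair (theta_t, z_t) of Nesterov's method. *)
Fixpoint nag (F : R -> R) (m theta0 : R) (t : nat) : R * R :=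
  match t with
  | O => (theta0, theta0)
  | S t' =>
      let '(theta, z) := nag F m theta0 t' in
      let y := nag_mix m t' theta z in
      (y - m * Derive F y,
       z - m * (nagA m (S t') - nagA m t') * Derive F y)
  end.

Definition nag_theta (F : R -> R) (m theta0 : R) (t : nat) : R :=
  fst (nag F m theta0 t).

Definition nag_z (F : R -> R) (m theta0 : R) (t : nat) : R :=
  snd (nag F m theta0 t).

Definition nag_y (F : R -> R) (m theta0 : R) (t : nat) : R :=
  nag_mix m t (nag_theta F m theta0 t) (nag_z F m theta0 t).

(* The triple (Theta_t, Z_t, Y_t). *)
Fixpoint path (m : R) (t : nat) : R * R * R :=
  match t with
  | O => (0, 0, 0)
  | S t' =>
      let '(_, Zp, Yp) := path m t' in
      let Th := Yp + m in
      let Z := Zp + m * (nagA m (S t') - nagA m t') in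
      (Th, Z, nag_mix m (S t') Th Z)
  end.

Definition path_Theta (m : R) (t : nat) : R := fst (fst (path m t)).

Definition path_Y (m : R) (t : nat) : R := snd (path m t).

(* Theta_0, Y_1, Theta_2, Y_2, Theta_3, Y_3, ...: since Theta_1 = Y_1, the
   even-index formula Theta_(j+1) at index 2j only starts at j = 1. *)
Definition knots (m : R) (n : nat) : R :=
  match n with
  | O => path_Theta m 0
  | _ => if Nat.even n then path_Theta m (Nat.div2 n + 1)
         else path_Y m (Nat.div2 n + 1)
  end.

Definition objective (m : R) : R -> R := glue (knots m) (fun _ => 1).

(* Main.v *)
Require Import Defs.
From Stdlib Require Import Reals Lra Lia.
From Coquelicot Require Import Coquelicot.
Open Scope R_scope.

(** The argument is that the path [(Theta_t, Y_t)] computed in advance, by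
    pretending that every gradient met by the method is [-1], is the true
    trajectory on the function built from it.

    Each building block [piece] starts as an affine function of slope [- d] and
    ends as one of slope [- delta], so the glued function is affine around
    each knot and its derivative at [s j] is [- d j] ([is_derive_glue_knot]).
    With all slopes equal to [1], the method meets the gradient [-1] as long as
    it visits knots only, and then its next points are those of the path, again
    knots; so by induction [nag] and [path] coincide ([nag_objective]).

    Between two consecutive knots the block with [d = delta = 1] climbs by half
    of its length, so the objective is [s / 2] at a knot [s]
    ([objective_knot]): it diverges along the trajectory because the path
    advances by at least [m] per iteration ([path_Theta_ge]).

    What remains is that the knots do increase.  This needs the leading point
    [Z_t] to be ahead of [Theta_t]; the lead is multiplied by a positive factor
    at each iteration and then grows by [m (B_(t+1) - B_t - 1)], which is
    positive as soon as [B_t > 0] ([path_lead_pos]). *)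

(** * The slope of a glued function at its knots *)

Lemma piece_start (theta m d delta : R) :
  theta < (2 - d) / 16 * m -> piece theta m d delta = - d * theta.
Proof. intros h; unfold piece; destruct Rlt_dec; [reflexivity|lra]. Qed.

Lemma piece_end (theta m d delta : R) :
  0 < m -> 0 < d -> 0 < delta -> (delta + 14) / 16 * m <= theta ->
  piece theta m d delta =
    - delta * theta
    + m * ((22 + d ^ 2 + delta ^ 2 - 4 * d + 28 * delta) / 32).
Proof.
intros hm hd hdelta h.
assert (h13 : 13 / 16 * m < theta) by nra.
assert (hd2 : 0 < d * m) by nra.
unfold piece.
destruct Rlt_dec; [exfalso; lra|].
destruct Rle_dec; [exfalso; lra|].
destruct Rlt_dec; [exfalso; lra|].
destruct Req_dec_T; [exfalso; lra|].
destruct Rlt_dec; [exfalso; lra|].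
destruct Rlt_dec; [exfalso; lra|reflexivity].
Qed.

Section Glue.

Variables s d : nat -> R.
Hypothesis s_incr : forall j, s j < s (S j).
Hypothesis d_range : forall j, 0 < d j <= 1.

(** The fraction 1/16 of an interval serves for all slopes at once: as they lie
    in [(0, 1]], the first affine part of a block has relative length
    [(2 - d) / 16 >= 1 / 16] and the last one [(2 - delta) / 16 >= 1 / 16]. *)
Lemma glue_right_of_knot (j : nat) (theta : R) :
  s j <= theta < s j + (s (S j) - s j) / 16 ->
  glue s d theta = glue s d (s j) - d j * (theta - s j).
Proof.
intros [h1 h2].
pose proof (s_incr j) as hs; pose proof (d_range j) as hd.
destruct (Rle_lt_or_eq_dec _ _ h1) as [h|<-]; [|ring].
rewrite (glue_piece s d j theta s_incr) by lra.
rewrite piece_start by nra; ring.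
Qed.

Lemma glue_left_of_knot (j : nat) (theta : R) :
  s (S j) - (s (S j) - s j) / 16 < theta <= s (S j) ->
  glue s d theta = glue s d (s (S j)) - d (S j) * (theta - s (S j)).
Proof.
intros [h1 h2].
pose proof (s_incr j) as hs.
pose proof (d_range j) as hd; pose proof (d_range (S j)) as hd'.
rewrite (glue_piece s d j theta s_incr) by lra.
rewrite (glue_piece s d j (s (S j)) s_incr) by lra.
rewrite !piece_end by nra; ring.
Qed.

(** The affine parts on both sides of a knot have the same slope, hence form
    one affine function on a neighbourhood of the knot. *)
Lemma is_derive_glue_knot (j : nat) : is_derive (glue s d) (s j) (- d j).
Proof.
apply is_derive_ext_loc
  with (fun theta => glue s d (s j) - d j * (theta - s j)).
2: { auto_derive; [exact I|ring]. }
pose proof (s_incr j) as hs.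
assert (hleft : exists eps, 0 < eps /\ forall theta, s j - eps < theta <= s j ->
          glue s d theta = glue s d (s j) - d j * (theta - s j)).
{ destruct j as [|i].
  - exists 1; split; [lra|]; intros theta h.
    rewrite !glue_left by lra; ring.
  - pose proof (s_incr i).
    exists ((s (S i) - s i) / 16); split; [lra|].
    exact (glue_left_of_knot i). }
destruct hleft as [eps [heps hleft]].
assert (hmin : 0 < Rmin eps ((s (S j) - s j) / 16)).
{ apply Rmin_glb_lt; lra. }
exists (mkposreal _ hmin); intros theta hball.
change (Rabs (theta - s j) < Rmin eps ((s (S j) - s j) / 16)) in hball.
pose proof (Rmin_l eps ((s (S j) - s j) / 16)).
pose proof (Rmin_r eps ((s (S j) - s j) / 16)).
apply Rabs_def2 in hball.
symmetry; destruct (Rle_dec theta (s j)).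
- apply hleft; lra.
- apply glue_right_of_knot; lra.
Qed.

End Glue.

(** At [d = delta = 1] the last formula of the block gives
    [- m + 48 / 32 m = m / 2] at its right end. *)
Lemma glue_knot_slope_1 (s : nat -> R) (j : nat) :
  (forall i, s i < s (S i)) ->
  glue s (fun _ => 1) (s j) = (s j - s 0%nat) / 2.
Proof.
intros hs; rewrite (glue_knot s _ j hs).
induction j as [|j IH]; cbn [knot_value]; [field|].
pose proof (hs j).
rewrite IH, piece_end by lra; field.
Qed.

(** * The coefficients of the method *)

Lemma nagB_nonneg (t : nat) : 0 <= nagB t.
Proof.
induction t as [|t IH]; cbn [nagB]; [lra|].
pose proof (sqrt_pos (4 * nagB t + 1)); lra.
Qed.

Lemma nagB_step (t : nat) : nagB t + 1 <= nagB (S t).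
Proof.
pose proof (nagB_nonneg t); cbn [nagB].
assert (sqrt 1 <= sqrt (4 * nagB t + 1)) by (apply sqrt_le_1; lra).
rewrite sqrt_1 in *; lra.
Qed.

Lemma nagB_step_lt (t : nat) : (0 < t)%nat -> nagB t + 1 < nagB (S t).
Proof.
intros ht; destruct t as [|t]; [lia|].
pose proof (nagB_nonneg t); pose proof (nagB_step t).
change (nagB (S (S t))) with
  (nagB (S t) + 1 / 2 * (1 + sqrt (4 * nagB (S t) + 1))).
assert (sqrt 1 < sqrt (4 * nagB (S t) + 1)) by (apply sqrt_lt_1; lra).
rewrite sqrt_1 in *; lra.
Qed.

Lemma nag_weight_range (m : R) (t : nat) :
  0 < m -> 0 < 1 - nagA m t / nagA m (S t) < 1.
Proof.
intros hm.
assert (0 < 1 / m) by (apply Rdiv_lt_0_compat; lra).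
pose proof (nagB_nonneg t); pose proof (nagB_step t).
assert (0 < nagA m t) by (unfold nagA; lra).
assert (nagA m t < nagA m (S t)) by (unfold nagA; lra).
assert (0 < nagA m t / nagA m (S t)) by (apply Rdiv_lt_0_compat; lra).
assert (nagA m t / nagA m (S t) < 1) by (apply Rlt_div_l; lra).
lra.
Qed.

(** * The path and its knots *)

Definition path_Z (m : R) (t : nat) : R := snd (fst (path m t)).

Lemma path_Theta_S (m : R) (t : nat) : path_Theta m (S t) = path_Y m t + m.
Proof.
unfold path_Theta, path_Y; cbn [path].
destruct (path m t) as [[a b] c]; reflexivity.
Qed.

Lemma path_Z_S (m : R) (t : nat) :
  path_Z m (S t) = path_Z m t + m * (nagA m (S t) - nagA m t).
Proof.
unfold path_Z; cbn [path].
destruct (path m t) as [[a b] c]; reflexivity.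
Qed.

Lemma path_Y_mix (m : R) (t : nat) :
  path_Y m t = nag_mix m t (path_Theta m t) (path_Z m t).
Proof.
destruct t as [|t].
- unfold path_Y, path_Theta, path_Z, nag_mix; cbn [path fst snd]; ring.
- unfold path_Y, path_Theta, path_Z; cbn [path].
  destruct (path m t) as [[a b] c]; reflexivity.
Qed.

Lemma path_Y_1 (m : R) : 0 < m -> path_Y m 1 = m.
Proof.
intros hm.
assert (hZ : path_Z m 1 = path_Theta m 1).
{ rewrite path_Z_S, path_Theta_S.
  unfold path_Z, path_Y, nagA, nagB; cbn [path fst snd].
  replace (4 * 0 + 1) with 1 by ring; rewrite sqrt_1; field; lra. }
rewrite path_Y_mix; unfold nag_mix; rewrite hZ, path_Theta_S.
unfold path_Y; cbn [path snd]; ring.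
Qed.

(** Mixing [Z_t] into [Theta_t] to form [Y_t] reduces the lead of [Z] over
    [Theta] to its fraction [A_t / A_(t+1)]; the gradient step then moves
    [Theta] by [m] and [Z] by [m (B_(t+1) - B_t)]. *)
Lemma path_lead_S (m : R) (t : nat) :
  path_Z m (S t) - path_Theta m (S t) =
    nagA m t / nagA m (S t) * (path_Z m t - path_Theta m t)
    + m * (nagB (S t) - nagB t - 1).
Proof.
rewrite path_Z_S, path_Theta_S, path_Y_mix.
unfold nag_mix.
replace (nagA m (S t) - nagA m t) with (nagB (S t) - nagB t)
  by (unfold nagA; ring).
ring.
Qed.

Lemma path_lead_nonneg (m : R) (t : nat) :
  0 < m -> path_Theta m t <= path_Z m t.
Proof.
intros hm; induction t as [|t IH].
- unfold path_Theta, path_Z; cbn [path fst snd]; lra.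
- pose proof (path_lead_S m t); pose proof (nag_weight_range m t hm).
  pose proof (nagB_step t); nra.
Qed.

(** The lead vanishes at [t = 0] and [t = 1], since [B_1 - B_0 = 1]. *)
Lemma path_lead_pos (m : R) (t : nat) :
  0 < m -> (2 <= t)%nat -> path_Theta m t < path_Z m t.
Proof.
intros hm ht; destruct t as [|t]; [lia|].
pose proof (path_lead_S m t); pose proof (nag_weight_range m t hm).
pose proof (path_lead_nonneg m t hm).
pose proof (nagB_step_lt t ltac:(lia)); nra.
Qed.

Lemma path_Theta_le_Y (m : R) (t : nat) : 0 < m -> path_Theta m t <= path_Y m t.
Proof.
intros hm; rewrite path_Y_mix; unfold nag_mix.
pose proof (nag_weight_range m t hm); pose proof (path_lead_nonneg m t hm); nra.
Qed.

Lemma path_Theta_lt_Y (m : R) (t : nat) :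
  0 < m -> (2 <= t)%nat -> path_Theta m t < path_Y m t.
Proof.
intros hm ht; rewrite path_Y_mix; unfold nag_mix.
pose proof (nag_weight_range m t hm); pose proof (path_lead_pos m t hm ht); nra.
Qed.

Lemma path_Theta_ge (m : R) (t : nat) : 0 < m -> INR t * m <= path_Theta m t.
Proof.
intros hm; induction t as [|t IH].
- unfold path_Theta; cbn [path fst INR]; lra.
- rewrite path_Theta_S, S_INR; pose proof (path_Theta_le_Y m t hm); lra.
Qed.

Lemma knots_even (m : R) (i : nat) :
  knots m (2 * S i) = path_Theta m (S (S i)).
Proof.
unfold knots; destruct (2 * S i)%nat eqn:e; [lia|]; rewrite <- e.
rewrite Nat.even_mul, Nat.div2_double, Nat.add_1_r; reflexivity.
Qed.

Lemma knots_odd (m : R) (i : nat) : knots m (S (2 * i)) = path_Y m (S i).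
Proof.
unfold knots.
rewrite Nat.even_succ, Nat.odd_mul, Nat.div2_succ_double, Nat.add_1_r.
reflexivity.
Qed.

Lemma knots_1 (m : R) : 0 < m -> knots m 1 = m.
Proof. exact (path_Y_1 m). Qed.

Lemma knots_incr (m : R) (j : nat) : 0 < m -> knots m j < knots m (S j).
Proof.
intros hm; destruct (Nat.Even_or_Odd j) as [[[|i] ->]|[i ->]].
- change (0 < knots m 1); rewrite knots_1 by exact hm; exact hm.
- rewrite knots_even, knots_odd; apply path_Theta_lt_Y; [exact hm|lia].
- replace (S (2 * i + 1)) with (2 * S i)%nat by lia; rewrite Nat.add_1_r.
  rewrite knots_even, knots_odd, path_Theta_S; lra.
Qed.

Lemma path_Y_is_knot (m : R) (t : nat) : exists j, path_Y m t = knots m j.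
Proof.
destruct t as [|t]; [exists 0%nat; reflexivity|].
exists (S (2 * t)); symmetry; apply knots_odd.
Qed.

Lemma path_Theta_is_knot (m : R) (t : nat) :
  0 < m -> exists j, path_Theta m t = knots m j.
Proof.
intros hm; destruct t as [|[|t]].
- exists 0%nat; reflexivity.
- exists 1%nat; rewrite knots_1, path_Theta_S by exact hm.
  unfold path_Y; cbn [path snd]; ring.
- exists (2 * S t)%nat; symmetry; apply knots_even.
Qed.

Lemma Sup_seq_knots (m : R) :
  0 < m -> Sup_seq (fun j => Finite (knots m j)) = p_infty.
Proof.
intros hm; apply is_sup_seq_unique; intros M.
destruct (INR_unbounded (M / m)) as [n hn].
apply Rlt_div_l in hn; [|exact hm].
destruct (path_Theta_is_knot m n hm) as [j hj].
exists j; cbn; rewrite <- hj; pose proof (path_Theta_ge m n hm); lra.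
Qed.

(** * The method on the objective *)

Lemma is_derive_objective_knot (m : R) (j : nat) :
  0 < m -> is_derive (objective m) (knots m j) (-1).
Proof.
intros hm; apply (is_derive_glue_knot (knots m) (fun _ => 1)).
- intros i; exact (knots_incr m i hm).
- intros _; lra.
Qed.

Lemma objective_knot (m : R) (j : nat) :
  0 < m -> objective m (knots m j) = knots m j / 2.
Proof.
intros hm; unfold objective.
rewrite glue_knot_slope_1 by (intros i; exact (knots_incr m i hm)).
unfold knots at 2, path_Theta; cbn [path fst]; field.
Qed.

(** The method evaluates the gradient at the [Y_t] only; these are knots, so
    every gradient is the [-1] that the path presupposes. *)
Lemma nag_objective (m : R) (t : nat) :
  0 < m -> nag (objective m) m 0 t = (path_Theta m t, path_Z m t).
Proof.
intros hm; induction t as [|t IH]; [reflexivity|].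
cbn [nag]; rewrite IH, <- path_Y_mix, path_Theta_S, path_Z_S.
destruct (path_Y_is_knot m t) as [j ->].
rewrite (is_derive_unique _ _ _ (is_derive_objective_knot m j hm)).
f_equal; ring.
Qed.

Lemma nag_theta_objective (m : R) (t : nat) :
  0 < m -> nag_theta (objective m) m 0 t = path_Theta m t.
Proof. intros hm; unfold nag_theta; rewrite nag_objective by exact hm; easy. Qed.

Lemma nag_y_objective (m : R) (t : nat) :
  0 < m -> nag_y (objective m) m 0 t = path_Y m t.
Proof.
intros hm; unfold nag_y, nag_theta, nag_z; rewrite nag_objective by exact hm.
symmetry; apply path_Y_mix.
Qed.

Section KnotSequence.

Variables (m : R) (u : nat -> R).
Hypothesis m_pos : 0 < m.
Hypothesis u_knot : forall k, exists j, u k = knots m j.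

Lemma ex_derive_objective_at_knots (k : nat) : ex_derive (objective m) (u k).
Proof.
destruct (u_knot k) as [j ->]; exists (-1).
exact (is_derive_objective_knot m j m_pos).
Qed.

Lemma is_lim_seq_objective_at_knots :
  (forall k, INR k * m <= u k) ->
  is_lim_seq (fun k => objective m (u k)) p_infty.
Proof.
intros hu; apply is_lim_seq_le_p_loc with (fun k => INR k * (m / 2)).
- exists 0%nat; intros k _; pose proof (hu k) as h.
  destruct (u_knot k) as [j hj]; rewrite hj in *.
  rewrite objective_knot by exact m_pos; lra.
- apply is_lim_seq_mult with p_infty (m / 2).
  + apply is_lim_seq_INR.
  + apply is_lim_seq_const.
  + apply is_Rbar_mult_p_infty_pos; cbn; lra.
Qed.

Lemma Inf_seq_objective_slope_at_knots :
  Inf_seq (fun k => Finite (Rabs (Derive (objective m) (u k)))) = Finite 1.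
Proof.
assert (hslope : forall k, Rabs (Derive (objective m) (u k)) = 1).
{ intros k; destruct (u_knot k) as [j ->].
  rewrite (is_derive_unique _ _ _ (is_derive_objective_knot m j m_pos)).
  rewrite Rabs_left; lra. }
apply is_inf_seq_unique; intros eps; pose proof (cond_pos eps).
split; [intros k|exists 0%nat]; cbn; rewrite hslope; lra.
Qed.

End KnotSequence.

Theorem proposition3p6 : forall m : R, 0 < m ->
  let F := objective m in
  let theta := nag_theta F m 0 in
  let y := nag_y F m 0 in
  knots m 1 = m /\
  (forall j : nat, knots m j < knots m (S j)) /\
  Sup_seq (fun j => Finite (knots m j)) = p_infty /\
  (forall k : nat, ex_derive F (theta k)) /\
  (forall k : nat, ex_derive F (y k)) /\
  is_lim_seq (fun k => F (theta k)) p_infty /\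
  is_lim_seq (fun k => F (y k)) p_infty /\
  Inf_seq (fun k => Finite (Rabs (Derive F (theta k)))) = Finite 1 /\
  Inf_seq (fun k => Finite (Rabs (Derive F (y k)))) = Finite 1.
Proof.
intros m hm F theta y.
assert (htheta : forall k, exists j, theta k = knots m j).
{ intros k; unfold theta, F; rewrite nag_theta_objective by exact hm.
  exact (path_Theta_is_knot m k hm). }
assert (hy : forall k, exists j, y k = knots m j).
{ intros k; unfold y, F; rewrite nag_y_objective by exact hm.
  exact (path_Y_is_knot m k). }
repeat split.
- exact (knots_1 m hm).
- intros j; exact (knots_incr m j hm).
- exact (Sup_seq_knots m hm).
- exact (ex_derive_objective_at_knots m theta hm htheta).
- exact (ex_derive_objective_at_knots m y hm hy).
- apply is_lim_seq_objective_at_knots; [exact hm|exact htheta|].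
  intros k; unfold theta, F; rewrite nag_theta_objective by exact hm.
  exact (path_Theta_ge m k hm).
- apply is_lim_seq_objective_at_knots; [exact hm|exact hy|].
  intros k; unfold y, F; rewrite nag_y_objective by exact hm.
  pose proof (path_Theta_ge m k hm); pose proof (path_Theta_le_Y m k hm); lra.
- exact (Inf_seq_objective_slope_at_knots m theta hm htheta).
- exact (Inf_seq_objective_slope_at_knots m y hm hy).
Qed.
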